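(* Let $f(t) = \sum_{m=1}^\infty \sum_{n=0}^\infty b_{m,n} t^{m} x^n$ be a formal power series in two variables $t$ and $x$ (with coefficients in a commutative ring, e.g. $\mathbb{C}$), and assume $b_{1,0} = 1$. Define $f^{(0)}(t) = t$ and $f^{(i)}(t) = f(f^{(i-1)}(t))$ for $i > 0$, where the composition substitutes $f^{(i-1)}(t)$ for the variable $t$ in $f$ while $x$ is left unchanged. Define a matrix $c$ by \[ c_{i,j} = [x^{j+1}] f^{(i)}(x) \qquad (i,j \geq 0), \] where $f^{(i)}(x)$ denotes the one-variable power series obtained by substituting $t = x$. Then \[ \det \left( (c_{i,j})_{i,j=0}^n\right) = \prod_{k=1}^n \left( \sum_{m=0}^k m!\, S(k+1,m+1)\, b_{2,0}^m\, b_{1,1}^{k-m} \right) \qquad (n = 0,1,2,\dots). \]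
   Context: $[x^j] g$ denotes the coefficient of $x^j$ in a power series $g$ in $x$. $S(a,b)$ denotes the Stirling number of the second kind, the number of partitions of a set of $a$ labeled objects into $b$ nonempty blocks. The convention $0^0 = 1$ is used in the powers $b_{2,0}^m b_{1,1}^{k-m}$. The empty product (for $n=0$) equals $1$. The iterates are well defined since $f$ has no term free of $t$. *)

(* Defs.v *)
From HB Require Import structures.
From mathcomp Require Import all_boot all_order all_algebra.

Set Implicit Arguments.
Unset Strict Implicit.
Unset Printing Implicit Defensive.

Import GRing.Theory.
Local Open Scope ring_scope.

(* A formal power series in t and x: [f m n] is the coefficient of t^m x^n. *)
Definition fps2 (R : comPzRingType) := nat -> nat -> R.

Section FPS2.
Variable R : comPzRingType.
Implicit Types f g : fps2 R.

Definition fps2_one : fps2 R := fun p q => ((p == 0%N) && (q == 0%N))%:R.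

Definition fps2_t : fps2 R := fun p q => ((p == 1%N) && (q == 0%N))%:R.

Definition fps2_mul f g : fps2 R := fun p q =>
  \sum_(i < p.+1) \sum_(j < q.+1) f i j * g (p - i)%N (q - j)%N.

Definition fps2_exp g (m : nat) : fps2 R := iter m (fps2_mul g) fps2_one.

(* f(g(t,x),x) = sum_(m,n) f_(m,n) g^m x^n, for g without term free of t.  The  *)
(* series g^m is then divisible by t^m, so that only the indices m <= p and     *)
(* n <= q contribute to the coefficient of t^p x^q (see fps2_comp_widen).       *)
Definition fps2_comp f g : fps2 R := fun p q =>
  \sum_(m < p.+1) \sum_(n < q.+1) f m n * fps2_exp g m p (q - n)%N.

Definition fps2_iter f (i : nat) : fps2 R := iter i (fps2_comp f) fps2_t.

(* The coefficient of x^k in the one-variable series g(x,x). *)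
Definition fps2_diag g (k : nat) : R := \sum_(p < k.+1) g p (k - p)%N.

Lemma fps2_exp_low g m p q :
  (forall n, g 0%N n = 0) -> (p < m)%N -> fps2_exp g m p q = 0.
Proof.
move=> g0; elim: m p q => // m IHm p q lt_pm.
rewrite /fps2_exp iterS -/(fps2_exp g m) /fps2_mul.
apply: big1 => i _; apply: big1 => j _.
case: (nat_of_ord i) (ltn_ord i) => [|i'] lt_ip; first by rewrite g0 mul0r.
rewrite IHm ?mulr0 //.
apply: leq_trans (_ : (p <= m)%N); last by rewrite -ltnS.
by rewrite ltn_subrL /=; apply: leq_trans (_ : (i'.+1 <= p)%N).
Qed.

Lemma fps2_comp_widen f g p q N :
    (forall n, g 0%N n = 0) -> (p < N)%N ->
  \sum_(m < N) \sum_(n < q.+1) f m n * fps2_exp g m p (q - n)%N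
  = fps2_comp f g p q.
Proof.
move=> g0 lt_pN; rewrite /fps2_comp.
rewrite [RHS](big_ord_widen N
  (fun m => \sum_(n < q.+1) f m n * fps2_exp g m p (q - n)%N)) //.
rewrite [LHS](bigID (fun m : 'I_N => (m < p.+1)%N)) /=.
rewrite [X in _ + X]big1 ?addr0 // => m; rewrite -leqNgt => lt_pm.
by apply: big1 => n _; rewrite fps2_exp_low ?mulr0.
Qed.

Lemma fps2_iter_t0 f i :
  (forall n, f 0%N n = 0) -> forall n, fps2_iter f i 0%N n = 0.
Proof.
move=> f0 n; case: i => [|i]; first by [].
rewrite /fps2_iter iterS {1}/fps2_comp big_ord1.
by apply: big1 => k _; rewrite f0 mul0r.
Qed.

End FPS2.

(* [partition P D] includes the condition that no block of P is empty. *)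
Definition stirling2 (a b : nat) : nat :=
  #|[set P : {set {set 'I_a}} | partition P [set: 'I_a] & #|P| == b]|.

(* Main.v *)
Require Import Defs.
From HB Require Import structures.
From mathcomp Require Import all_boot all_order all_algebra.
From mathcomp Require Import ring.

Set Implicit Arguments.
Unset Strict Implicit.
Unset Printing Implicit Defensive.

Import GRing.Theory.
Local Open Scope ring_scope.

(* Substituting t = s x turns f into x F(s), where F is a power series in x     *)
(* over R[s] congruent to s + (b_{2,0} s^2 + b_{1,1} s) x modulo x^2, and turns *)
(* f^(i) into x times the i-th iterate of F in s; hence c_{i,j} is the          *)
(* coefficient of x^j in that iterate at s = 1.  Let Delta be the operator      *)
(* G |-> G(F) - G.  Since the iterate is sum_j C(i,j) Delta^j s, the matrix c   *)
(* is the product of the unitriangular Pascal matrix and the matrix of          *)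
(* coefficients of (Delta^j s)(1).  By Taylor expansion Delta = x D modulo x^2, *)
(* with D = (b_{2,0} s^2 + b_{1,1} s) d/ds, so the second factor is upper       *)
(* triangular with diagonal entries (D^k s)(1), and the recurrence for S(k,m)   *)
(* is exactly the one for the coefficients of D^k s.                            *)

(** A coefficient of an iterate involves only finitely many coefficients of [b], so the argument
    runs in [{poly {poly R}}] on a truncation ([truncates_to_iter], [diag_iter]). There
    [iter_comp_poly_delta] gives the Pascal factorization, [iter_delta_rescaled] the triangularity
    of the second factor, and [iter_quad_derivation] its diagonal. The Stirling recurrence comes
    from counting set partitions in [card_partitions_intoU1]. *)

Section SetPartitions.
Variable T : finType.
Implicit Types (D B : {set T}) (P : {set {set T}}).
Local Open Scope nat_scope.

Definition partitions_into D (b : nat) : {set {set {set T}}} :=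
  [set P | partition P D & #|P| == b].

Variables (D : {set T}) (x : T).
Hypothesis xD : x \notin D.

Lemma partition_notin_block P B : partition P D -> B \in P -> x \notin B.
Proof. by move=> pP PB; apply: contraNN xD; apply/subsetP/(partitionS pP). Qed.

Definition add_to_block (u : {set {set T}} * {set T}) : {set {set T}} :=
  (x |: u.2) |: (u.1 :\ u.2).

Lemma add_to_block_notin P B :
  partition P D -> x |: B \notin P :\ B.
Proof.
move=> pP; apply/setD1P => -[_ /(partition_notin_block pP)].
by rewrite setU11.
Qed.

Lemma add_to_block_partition P B :
  partition P D -> B \in P -> partition (add_to_block (P, B)) (x |: D).
Proof.
move=> pP PB; have sBD := partitionS pP PB.
have -> : x |: D = (x |: B) :|: (D :\: B).
  by rewrite -setUA -{1}(setID D B) (setIidPr sBD).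
apply: partitionU1 (partitionD1 pP PB) _ _.
  by apply/set0Pn; exists x; rewrite setU11.
rewrite -setI_eq0; apply/eqP/setP => y; rewrite !inE.
by have [->|] := eqVneq y x; [rewrite (negbTE xD) andbF | case: (y \in B)].
Qed.

(** The block containing [x], with [x] deleted, recovers [B]; restoring [B] then recovers [P]. *)
Lemma add_to_block_inj b :
  {in [set u : {set {set T}} * {set T} |
          (u.1 \in partitions_into D b) && (u.2 \in u.1)] &,
    injective add_to_block}.
Proof.
move=> [P B] [P' B']; rewrite !inE /= => /andP[/andP[pP _] PB].
move=> /andP[/andP[pP' _] PB'] eq_add.
have xB := partition_notin_block pP PB.
have xB' := partition_notin_block pP' PB'.
have eq_xB : x |: B = x |: B'.
  have blk P1 B1 : partition P1 D -> B1 \in P1 ->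
      pblock (add_to_block (P1, B1)) x = x |: B1.
    move=> pP1 PB1; apply: def_pblock; rewrite ?setU11 //.
    exact: partition_trivIset (add_to_block_partition pP1 PB1).
  by rewrite -(blk P) // -(blk P') // eq_add.
have eqB : B = B' by rewrite -(setU1K xB) -(setU1K xB') eq_xB.
rewrite -eqB in pP' PB' eq_add *; congr (_, _).
rewrite -(setD1K PB) -(setD1K PB'); congr (_ |: _).
rewrite -(setU1K (add_to_block_notin B pP)).
by rewrite -(setU1K (add_to_block_notin B pP')) -/(add_to_block (P, B)) eq_add.
Qed.

Lemma partitions_with_singleton b :
  partitions_into (x |: D) b.+1 :&: [set P : {set {set T}} | [set x] \in P]
  = [set [set x] |: P | P in partitions_into D b].
Proof.
apply/setP=> P; apply/idP/imsetP => [|[Q]].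
  rewrite !inE => /andP[/andP[pP /eqP cP] xP].
  exists (P :\ [set x]); last by rewrite setD1K.
  rewrite inE; move: cP (partitionD1 pP xP).
  by rewrite (cardsD1 [set x]) xP add1n setU1K // => -[->] ->; rewrite eqxx.
rewrite inE => /andP[pQ /eqP cQ] ->; rewrite !inE eqxx /= andbT.
have x1 : [set x] \notin Q.
  by apply/negP => /(partition_notin_block pQ); rewrite set11.
rewrite cardsU1 x1 cQ add1n eqxx andbT; apply: partitionU1 => //.
  by apply/set0Pn; exists x; rewrite set11.
by rewrite disjoints1.
Qed.

Lemma partitions_without_singleton b :
  partitions_into (x |: D) b :\: [set P : {set {set T}} | [set x] \in P]
  = add_to_block @:
      [set u : {set {set T}} * {set T} |
          (u.1 \in partitions_into D b) && (u.2 \in u.1)].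
Proof.
apply/setP=> P; apply/idP/imsetP => [|[[Q B]]]; last first.
  rewrite !inE /= => /andP[/andP[pQ /eqP cQ] QB] ->.
  rewrite add_to_block_partition //= cardsU1 add_to_block_notin //=.
  rewrite -cQ (cardsD1 B Q) QB eqxx !andbT !inE negb_or negb_and.
  apply/andP; split.
    apply/eqP => eqx; have /set0Pn[y By] := partition_neq0 pQ QB.
    have : y \in [set x] by rewrite eqx inE By orbT.
    rewrite inE => /eqP yx; have := partition_notin_block pQ QB.
    by rewrite -yx By.
  apply/orP; right.
  by apply/negP => /(partition_notin_block pQ); rewrite set11.
rewrite !inE => /andP[x1 /andP[pP /eqP cP]].
have xP : x \in cover P by rewrite (cover_partition pP) setU11.
set B := pblock P x; have PB : B \in P by apply: pblock_mem.
have xB : x \in B by rewrite mem_pblock.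
(* The preimage replaces [B] by [C], which is nonempty because [[set x]] is not a block. *)
set C := B :\ x; have defB : B = x |: C by rewrite setD1K.
have sB : B \subset x |: D := partitionS pP PB.
have C0 : C != set0.
  by apply: contraNneq x1 => C0; rewrite -(setU0 [set x]) -C0 -defB.
have disC : [disjoint C & (x |: D) :\: B].
  rewrite -setI_eq0; apply/eqP/setP => y; rewrite !inE.
  by case: (y \in B); rewrite ?andbF.
have pPB := partitionD1 pP PB.
have CP : C \notin P :\ B.
  apply/negP => /(partitionS pPB) sC; have /set0Pn[y Cy] := C0.
  by move/pred0P: disC => /(_ y) /=; rewrite Cy (subsetP sC).
exists (C |: (P :\ B), C); last first.
  by rewrite /add_to_block /= setU1K // -defB setD1K.
rewrite !inE /= eqxx andbT cardsU1 CP -cP (cardsD1 B P) PB eqxx andbT.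
have -> : D = C :|: ((x |: D) :\: B).
  apply/setP => y; rewrite !inE; have [->|yx] /= := eqVneq y x.
    by rewrite xB (negbTE xD).
  case yB: (y \in B) => //=; move/subsetP: sB => /(_ y yB).
  by rewrite !inE (negbTE yx).
exact: partitionU1.
Qed.

(** Either [x] forms a block alone, or it joins one of the [b.+1] blocks of a partition of [D]. *)
Lemma card_partitions_intoU1 b :
  #|partitions_into (x |: D) b.+1|
  = b.+1 * #|partitions_into D b.+1| + #|partitions_into D b|.
Proof.
rewrite -(cardsID [set P : {set {set T}} | [set x] \in P]) addnC.
rewrite partitions_with_singleton partitions_without_singleton.
congr (_ + _); last first.
  rewrite card_in_imset // => P Q; rewrite !inE.
  move=> /andP[pP _] /andP[pQ _] eqPQ.
  have x1 P1 : partition P1 D -> [set x] \notin P1.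
    by move=> pP1; apply/negP => /(partition_notin_block pP1); rewrite set11.
  by rewrite -(setU1K (x1 _ pP)) eqPQ setU1K ?x1.
rewrite (card_in_imset (@add_to_block_inj b.+1)).
rewrite -sum1dep_card -(pair_big_dep (mem (partitions_into D b.+1))
  (fun P B => B \in P) (fun _ _ => 1)) /=.
under eq_bigr => P PD do rewrite sum1_card.
rewrite (eq_bigr (fun _ => b.+1)) ?sum_nat_const 1?mulnC // => P.
by rewrite inE => /andP[_ /eqP].
Qed.

End SetPartitions.

Lemma card_partitions_into0 (T : finType) b :
  #|partitions_into (set0 : {set T}) b| = (b == 0)%N.
Proof.
case: b => [|b].
  rewrite -[RHS](cards1 (set0 : {set {set T}})); apply: eq_card => P.
  by rewrite !inE partition_set0; case: eqP => // ->; rewrite cards0.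
apply: eq_card0 => P; rewrite !inE partition_set0.
by case: eqP => // ->; rewrite cards0.
Qed.

Lemma card_partitions_into_none (T : finType) (D : {set T}) :
  D != set0 -> #|partitions_into D 0| = 0%N.
Proof.
move=> D0; apply: eq_card0 => P; rewrite !inE; apply/negP => /andP[pP].
rewrite cards_eq0 => /eqP P0; case/negP: D0.
by rewrite -(cover_partition pP) P0 /cover big_set0.
Qed.

Fixpoint stirling2_rec (a b : nat) : nat :=
  match a, b with
  | 0, 0 => 1
  | a'.+1, b'.+1 => b'.+1 * stirling2_rec a' b'.+1 + stirling2_rec a' b'
  | _, _ => 0
  end.

Lemma card_partitions_into (T : finType) (D : {set T}) b :
  #|partitions_into D b| = stirling2_rec #|D| b.
Proof.
have [k] := ubnP #|D|; elim: k D b => // k IHk D b; rewrite ltnS => le_Dk.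
have [->|/[dup] D0 /set0Pn[x Dx]] := eqVneq D set0.
  by rewrite cards0 card_partitions_into0; case: b.
rewrite (cardsD1 x) Dx add1n; case: b => [|b].
  exact: card_partitions_into_none.
rewrite -{1}(setD1K Dx) card_partitions_intoU1 ?setD11 //.
by rewrite !IHk // (leq_trans _ le_Dk) // [X in (_ < X)%N](cardsD1 x) Dx.
Qed.

Lemma stirling2E a b : stirling2 a b = stirling2_rec a b.
Proof. by rewrite -[in RHS](card_ord a) -cardsT -card_partitions_into. Qed.

Lemma stirling2_rec_small a b : (a < b)%N -> stirling2_rec a b = 0%N.
Proof.
elim: a b => [|a IHa] [|b] //=; rewrite ltnS => ltab.
by rewrite !IHa ?muln0 // ltnW.
Qed.

Lemma stirling2S k m :
  stirling2 k.+1 m.+1 = (m.+1 * stirling2 k m.+1 + stirling2 k m)%N.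
Proof. by rewrite !stirling2E. Qed.

(** * Polynomial composition and its difference operator *)

Section PolyComposition.
Variable R : comNzRingType.
Implicit Types p q h : {poly R}.

Lemma coef_exp_low q m i : q`_0 = 0 -> (i < m)%N -> (q ^+ m)`_i = 0.
Proof.
move=> q0; elim: m i => // m IHm i lt_im; rewrite exprS coefM big1 // => j _.
case: (nat_of_ord j) (ltn_ord j) => [|k] ltki; first by rewrite q0 mul0r.
rewrite IHm ?mulr0 //; apply: leq_trans (_ : i <= m)%N; last by rewrite -ltnS.
by rewrite ltn_subrL /=; apply: leq_trans (_ : k.+1 <= i)%N.
Qed.

Lemma coef0_comp_poly p q : q`_0 = 0 -> (p \Po q)`_0 = p`_0.
Proof.
by move=> q0; rewrite -!horner_coef0 horner_comp (horner_coef0 q) q0.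
Qed.

Lemma coef_comp_scaleX p c i : (p \Po (c *: 'X))`_i = p`_i * c ^+ i.
Proof.
elim/poly_ind: p i => [|p a IHp] i; first by rewrite comp_poly0 !coef0 mul0r.
rewrite comp_poly_MXaddC !coefD -scalerAr coefZ !coefMX !coefC.
by case: i => [|i] /=; rewrite ?mulr0 ?expr0 ?mulr1 // !addr0 IHp exprS mulrCA.
Qed.

Lemma comp_poly_taylor1 p h :
  exists e, p \Po ('X + h) = p + p^`() * h + h ^+ 2 * e.
Proof.
elim/poly_ind: p => [|p a [e IHp]].
  by exists 0; rewrite comp_poly0 deriv0; ring.
exists (p^`() + e * 'X + e * h).
rewrite comp_poly_MXaddC IHp derivD derivM derivX derivC; ring.
Qed.

(** Composition is associative. The left form matches [fps2_iter]; the right one iterates a map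
    linear in [r], as the difference operator requires. *)
Lemma iter_comp_poly_swap p i :
  iter i (fun r => p \Po r) 'X = iter i (fun r => r \Po p) 'X.
Proof.
elim: i => // i IHi; rewrite iterSr [RHS]iterS comp_polyXr -IHi.
rewrite -{1}[p in iter i _ p]comp_polyX.
by elim: i {IHi} => //= i ->; rewrite comp_polyA.
Qed.

Definition comp_delta p r := r \Po p - r.

(** Binomial expansion of the [i]-th power of the identity plus [comp_delta p]. *)
Lemma iter_comp_poly_delta p i r :
  iter i (fun r => r \Po p) r
  = \sum_(j < i.+1) iter j (comp_delta p) r *+ 'C(i, j).
Proof.
elim: i => [|i IHi]; first by rewrite big_ord1 bin0.
rewrite iterS IHi raddf_sum [RHS]big_ord_recl bin0.
rewrite [X in _ = _ + X](eq_bigr (fun j : 'I_i.+1 =>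
  iter j.+1 (comp_delta p) r *+ 'C(i, j.+1)
  + iter j.+1 (comp_delta p) r *+ 'C(i, j))); last first.
  by move=> j _; rewrite lift0 binS mulrnDr.
rewrite big_split /= addrA.
have -> : r *+ 1 + \sum_(j < i.+1) iter j.+1 (comp_delta p) r *+ 'C(i, j.+1)
        = \sum_(j < i.+1) iter j (comp_delta p) r *+ 'C(i, j).
  have := @big_ord_recr _ 0 +%R i.+1
    (fun j : 'I_i.+2 => iter j (comp_delta p) r *+ 'C(i, j)).
  rewrite /= bin_small // mulr0n addr0 => <-; rewrite [RHS]big_ord_recl bin0.
  by congr (_ + _); apply: eq_bigr => j _; rewrite lift0.
rewrite -big_split; apply: eq_bigr => j _ /=.
by rewrite raddfMn -mulrnDl addrC subrK.
Qed.

End PolyComposition.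

(** * Iterates of the derivation and Stirling numbers *)

Section Derivation.
Variables (R : comNzRingType) (a c : R).

Definition quad_derivation (p : {poly R}) := (a *: 'X^2 + c *: 'X) * p^`().

Definition stirling_coef (k m : nat) : R :=
  (m`! * stirling2 k.+1 m.+1)%:R * a ^+ m * c ^+ (k - m).

Lemma iter_quad_derivation k :
  iter k quad_derivation 'X = \sum_(m < k.+1) stirling_coef k m *: 'X^(m.+1).
Proof.
elim: k => [|k IHk].
  rewrite big_ord1 /stirling_coef stirling2E /= !expr0 !mulr1 scale1r.
  by rewrite expr1.
rewrite iterS IHk /quad_derivation raddf_sum mulr_sumr /=.
(* [A m] and [C m] come from the quadratic and the linear term of the derivation applied to
   ['X^(m.+1)]. *)
pose A m := (m.+1`! * stirling2 k.+1 m.+1)%:R * a ^+ m.+1 * c ^+ (k - m).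
pose C m := (m.+1`! * stirling2 k.+1 m.+1)%:R * a ^+ m * c ^+ (k.+1 - m).
transitivity (\sum_(m < k.+1) (A m *: 'X^(m.+2) + C m *: 'X^(m.+1))).
  apply: eq_bigr => m _; rewrite derivZ derivXn /= /A /C /stirling_coef.
  rewrite (subSn (leq_ord m)) factS -mulnA; set s := (m`! * _)%N.
  rewrite natrM !exprS -!mul_polyC; ring.
(* The extra term [C k.+1] vanishes, since [stirling2 k.+1 k.+2] is 0. *)
transitivity (\sum_(m < k.+2) C m *: 'X^(m.+1)
              + \sum_(m < k.+1) A m *: 'X^(m.+2)).
  rewrite big_split addrC; congr (_ + _); rewrite [RHS]big_ord_recr /= {3}/C.
  by rewrite stirling2E stirling2_rec_small // muln0 !mul0r scale0r addr0.
rewrite [in RHS]big_ord_recl [in LHS]big_ord_recl /= -addrA -big_split.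
congr (_ + _).
  rewrite /C /stirling_coef fact0 factS fact0 (stirling2S k.+1 0).
  have -> : stirling2 k.+1 0 = 0%N by rewrite stirling2E.
  by rewrite addn0 !mul1n.
apply: eq_bigr => m _ /=; rewrite -scalerDl; congr (_ *: _).
rewrite /A /C /stirling_coef ?lift0 subSS /bump leq0n add1n.
rewrite (stirling2S k.+1 m.+1).
by rewrite mulnDr natrD !mulrDl mulnA [m.+2`!]factS [(m.+2 * _)%N]mulnC.
Qed.

End Derivation.

(** * Polynomial truncations of bivariate series *)

Section Truncation.
Variable R : comNzRingType.
Implicit Types (f g : fps2 R) (P Q : {poly {poly R}}).

(* In [{poly {poly R}}] the outer variable is t and the inner one is x. *)
Definition truncates_to (N : nat) f P :=
  forall p q, (p < N)%N -> (q < N)%N -> f p q = P`_p`_q.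

Lemma truncates_to_mul N f g P Q :
  truncates_to N f P -> truncates_to N g Q ->
  truncates_to N (fps2_mul f g) (P * Q).
Proof.
move=> fP gQ p q ltp ltq; rewrite /fps2_mul coefM coef_sum.
apply: eq_bigr => i _; rewrite coefM; apply: eq_bigr => j _.
by rewrite fP ?gQ //; apply: leq_ltn_trans (leq_subr _ _) _ ||
   apply: leq_trans (ltn_ord _) _.
Qed.

Lemma truncates_to_exp N g Q m :
  truncates_to N g Q -> truncates_to N (fps2_exp g m) (Q ^+ m).
Proof.
move=> gQ; elim: m => [|m IHm]; last by rewrite exprS; apply: truncates_to_mul.
move=> p q _ _; rewrite expr0 /fps2_exp /= /fps2_one coef1.
by case: p => [|p] /=; rewrite ?coef1 ?coef0.
Qed.

Lemma truncates_to_comp N f g P Q : Q`_0 = 0 ->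
  truncates_to N f P -> truncates_to N g Q ->
  truncates_to N (fps2_comp f g) (P \Po Q).
Proof.
move=> Q0 fP gQ p q ltp ltq; rewrite coef_comp_poly.
pose G m := P`_m * (Q ^+ m)`_p.
have -> : \sum_(m < size P) P`_m * (Q ^+ m)`_p = \sum_(m < p.+1) G m.
  set M := maxn (size P) p.+1.
  rewrite (big_ord_widen M G) ?leq_maxl // (big_ord_widen M G) ?leq_maxr //.
  rewrite big_mkcond [in RHS]big_mkcond; apply: eq_bigr => m _ /=.
  case: ltnP => sP; case: ltnP => pm //.
    by rewrite /G coef_exp_low ?mulr0.
  by rewrite /G nth_default ?mul0r.
rewrite coef_sum; apply: eq_bigr => m _; rewrite coefM; apply: eq_bigr => n _.
rewrite fP; first 1 last.
- by apply: leq_trans (ltn_ord _) _.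
- by apply: leq_trans (ltn_ord _) _.
by rewrite (truncates_to_exp m gQ) //; apply: leq_ltn_trans (leq_subr _ _) _.
Qed.

Lemma truncates_to_iter N f P i : P`_0 = 0 -> truncates_to N f P ->
  truncates_to N (fps2_iter f i) (iter i (fun Q => P \Po Q) 'X).
Proof.
move=> P0 fP; elim: i => [|i IHi].
  move=> p q _ _; rewrite /fps2_iter /= /fps2_t coefX.
  by case: eqP => _ /=; rewrite ?coef1 ?coef0.
rewrite iterS; apply: truncates_to_comp => //.
by elim: i {IHi} => [|i IHi] /=; rewrite ?coefX // coef0_comp_poly.
Qed.

Lemma truncates_to_diag N f P k : truncates_to N f P -> (k < N)%N ->
  fps2_diag f k = (P.['X])`_k.
Proof.
move=> fP ltk; rewrite horner_coef coef_sum /fps2_diag.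
pose G m := if (m < k.+1)%N then P`_m`_(k - m) else 0.
set M := maxn (size P) k.+1.
transitivity (\sum_(m < M) G m).
  rewrite (big_ord_widen M (fun p => f p (k - p)%N)) ?leq_maxr //.
  rewrite big_mkcond; apply: eq_bigr => m _; rewrite /G.
  case: ifP => // ltm; rewrite fP //; first exact: leq_trans ltm _.
  exact: leq_ltn_trans (leq_subr _ _) _.
under [RHS]eq_bigr => m _ do rewrite coefMXn ltnNge -[(m <= k)%N]ltnS if_neg.
rewrite [RHS](big_ord_widen M G) ?leq_maxl // [RHS]big_mkcond.
apply: eq_bigr => m _; case: ltnP => // sP.
by rewrite /G (nth_default 0 sP) coef0 if_same.
Qed.

End Truncation.

(** * The substitution t = s x and reduction modulo x *)

Section Rescaling.
Variables (R : comNzRingType) (b : fps2 R).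
Hypotheses (b0 : forall n : nat, b 0%N n = 0) (b10 : b 1%N 0%N = 1).
Variable N : nat.
Hypothesis N_gt1 : (1 < N)%N.

(* A truncation of f(t, x) / t. *)
Definition trunc_quot : {poly {poly R}} :=
  \poly_(m < N) \poly_(n < N) b m.+1 n.

(* The series F(s) = f(s x, x) / x, truncated. *)
Definition rescaled : {poly {poly R}} := 'X * (trunc_quot \Po ('X *: 'X)).

Lemma truncates_to_trunc : truncates_to N b ('X * trunc_quot).
Proof.
move=> [|p] q ltp ltq; rewrite coefXM /= ?b0 ?coef0 //.
by rewrite coef_poly ltnW // coef_poly ltq.
Qed.

(** The scaling ['X *: 'X] (inner x times outer s) conjugates the truncation of f to [rescaled],
    hence also their iterates. *)
Lemma iter_rescaled i :
  iter i (fun Q => ('X * trunc_quot) \Po Q) 'X \Po ('X *: 'X)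
  = 'X *: iter i (fun Q => rescaled \Po Q) 'X.
Proof.
elim: i => [|i IHi]; first by rewrite comp_polyX.
rewrite !iterS -comp_polyA IHi /rescaled.
set G := iter i _ _; have -> : 'X *: G = ('X *: 'X) \Po G :> {poly {poly R}}.
  by rewrite comp_polyZ comp_polyX.
by rewrite comp_polyA comp_polyM comp_polyX -scalerAl comp_polyZ.
Qed.

(** Setting t = x means s = 1; the prefactor x shifts [j.+1] to [j]. *)
Lemma diag_iter i j : (j.+1 < N)%N ->
  fps2_diag (fps2_iter b i) j.+1
  = (iter i (fun Q => Q \Po rescaled) 'X).[1]`_j.
Proof.
move=> ltj; rewrite (truncates_to_diag (P :=
  iter i (fun Q => ('X * trunc_quot) \Po Q) 'X) (N := N)) //; last first.
  by apply: truncates_to_iter truncates_to_trunc; rewrite coefXM.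
rewrite -iter_comp_poly_swap -[j.+1]add1n.
rewrite -[X in _.[X]](_ : ('X *: 'X : {poly {poly R}}).[1] = 'X); last first.
  by rewrite hornerZ hornerX mulr1.
by rewrite -horner_comp iter_rescaled hornerZ coefXM.
Qed.

(** This is (F(s) - s) / x: [drop_poly 1] divides each coefficient by x, exactly so by
    [rescaledE]. *)
Definition rescaled_slope : {poly {poly R}} :=
  map_poly (drop_poly 1) (rescaled - 'X).

Lemma coef_rescaled i :
  rescaled`_i = if i is i'.+1 then trunc_quot`_i' * 'X^i' else 0.
Proof. by rewrite coefXM; case: i => //= i; rewrite coef_comp_scaleX. Qed.

Lemma rescaledE : rescaled = 'X + 'X *: rescaled_slope.
Proof.
suff <- : rescaled - 'X = 'X *: rescaled_slope by rewrite addrC subrK.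
apply/polyP => i.
rewrite coefZ coef_map_id0; last first.
  by apply/polyP=> k; rewrite coef_drop_poly !coef0.
apply/polyP => -[|k]; last by rewrite coefXM coef_drop_poly addn1.
rewrite coefXM /= coefB coef_rescaled coefX.
case: i => [|[|i]] /=; rewrite ?subr0 ?coef0 //; last by rewrite coefMXn.
by rewrite expr0 mulr1 coefB coef1 coef_poly ltnW // coef_poly ltnW // b10
  subrr.
Qed.

Lemma rescaled_slope0 :
  map_poly (coefp 0) rescaled_slope = b 2%N 0%N *: 'X^2 + b 1%N 1%N *: 'X.
Proof.
apply/polyP => i; rewrite coef_map coef_map_id0; last first.
  by apply/polyP=> k; rewrite coef_drop_poly !coef0.
rewrite /= coef_drop_poly add0n !coefB coef_rescaled coefD !coefZ !coefX coefXn.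
case: i => [|[|[|i]]] /=; rewrite ?coef0 ?mulr0 ?mulr1 ?add0r ?oppr0 ?addr0 //.
- by rewrite coef1 subr0 coef_poly ltnW // coef_poly N_gt1.
- by rewrite expr1 coefMX /= coef_poly N_gt1 coef_poly ltnW.
- by rewrite coefMXn.
Qed.

Lemma map_coefp0_MDZX (P Q S : {poly {poly R}}) :
  map_poly (coefp 0) (P * Q + 'X *: S)
  = map_poly (coefp 0) P * map_poly (coefp 0) Q.
Proof.
rewrite rmorphD rmorphM [X in _ + X](_ : _ = 0) ?addr0 //.
by apply/polyP => i; rewrite coef_map coefZ /= coefXM coef0.
Qed.

(** By Taylor expansion at s, each difference gains a factor x and, modulo x, differentiates the
    cofactor by [quad_derivation]. *)
Lemma iter_delta_rescaled k : exists2 Q,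
  iter k (comp_delta rescaled) 'X = 'X^k *: Q &
  map_poly (coefp 0) Q = iter k (quad_derivation (b 2%N 0%N) (b 1%N 1%N)) 'X.
Proof.
elim: k => [|k [Q IHk redQ]].
  by exists 'X; rewrite ?scale1r // map_polyX.
have [e eqQ] := comp_poly_taylor1 Q ('X *: rescaled_slope).
rewrite -rescaledE in eqQ.
exists (Q^`() * rescaled_slope + 'X *: (rescaled_slope ^+ 2 * e)).
  rewrite iterS IHk /comp_delta comp_polyZ -scalerBr eqQ.
  rewrite [in RHS]exprSr -scalerA.
  by congr (_ *: _); rewrite -!mul_polyC; ring.
rewrite map_coefp0_MDZX.
by rewrite iterS -redQ /quad_derivation deriv_map rescaled_slope0 mulrC.
Qed.

End Rescaling.

(** * The determinant *)

Lemma det_fps2_iter_nz (R : comNzRingType) (b : fps2 R)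
    (b0 : forall n : nat, b 0%N n = 0) (b10 : b 1%N 0%N = 1) (n : nat) :
  \det (\matrix_(i < n.+1, j < n.+1) fps2_diag (fps2_iter b i) j.+1)
  = \prod_(1 <= k < n.+1)
      \sum_(0 <= m < k.+1)
        (m`! * stirling2 k.+1 m.+1)%:R * b 2%N 0%N ^+ m * b 1%N 1%N ^+ (k - m).
Proof.
(* Order [n.+2] suffices: [diag_iter] needs [j.+1 < N] for [j <= n]. *)
pose F := rescaled b n.+2; have gt1 : (1 < n.+2)%N by [].
pose d k : {poly R} := (iter k (comp_delta F) 'X).[1].
pose L : 'M[R]_n.+1 := \matrix_(i, j) ('C(i, j))%:R.
pose U : 'M[R]_n.+1 := \matrix_(i, j) (d i)`_j.
have -> : \matrix_(i < n.+1, j < n.+1) fps2_diag (fps2_iter b i) j.+1 = L *m U.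
  apply/matrixP => i j.
  rewrite !mxE (diag_iter b0 (N := n.+2)); last by rewrite ltnS.
  rewrite iter_comp_poly_delta horner_sum coef_sum.
  rewrite (big_ord_widen n.+1
    (fun k => ((iter k (comp_delta F) 'X *+ 'C(i, k)).[1])`_j)) //.
  rewrite big_mkcond; apply: eq_bigr => k _; rewrite !mxE.
  rewrite hornerMn coefMn mulr_natl; case: ltnP => // lt_ik.
  by rewrite bin_small.
have d_low : forall k j, (j < k)%N -> (d k)`_j = 0.
  move=> k j ltjk; rewrite /d; have [Q -> _] := iter_delta_rescaled b10 gt1 k.
  by rewrite hornerZ coefXnM ltjk.
rewrite det_mulmx det_trig; last first.
  by apply/is_trig_mxP => i j ltij; rewrite mxE bin_small.
rewrite big1 ?mul1r => [|i _]; last by rewrite mxE binn.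
rewrite -det_tr det_trig; last first.
  by apply/is_trig_mxP => i j ltij; rewrite !mxE d_low.
rewrite (eq_bigr (fun i : 'I_n.+1 => (d i)`_i)) => [|i _]; last by rewrite !mxE.
rewrite -(big_mkord xpredT (fun k => (d k)`_k)) big_ltn //.
(* The diagonal entry at index 0 is 1, so the product starts at 1. *)
rewrite [X in X * _](_ : _ = 1) ?mul1r; last by rewrite /d /= hornerX coef1.
apply: eq_bigr => k _; rewrite /d.
have [Q -> redQ] := iter_delta_rescaled b10 gt1 k.
(* Reduction modulo x commutes with evaluation at s = 1. *)
rewrite hornerZ coefXnM ltnn subnn -[LHS]/(coefp 0 Q.[1]) -horner_map redQ.
rewrite iter_quad_derivation horner_sum big_mkord; apply: eq_bigr => m _.
by rewrite hornerZ /= coef1 hornerXn expr1n mulr1.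
Qed.

Theorem theorem3 (R : comPzRingType) (b : fps2 R)
    (b0 : forall n : nat, b 0%N n = 0) (b10 : b 1%N 0%N = 1) (n : nat) :
  \det (\matrix_(i < n.+1, j < n.+1) fps2_diag (fps2_iter b i) j.+1)
  = \prod_(1 <= k < n.+1)
      \sum_(0 <= m < k.+1)
        (m`! * stirling2 k.+1 m.+1)%:R * b 2%N 0%N ^+ m * b 1%N 1%N ^+ (k - m).
Proof.
(* [{poly R}] requires 1 != 0 in R, hence the separate case of the zero ring. *)
have [R0|] := eqVneq (1 : R) 0.
  by rewrite -[LHS]mulr1 -[RHS]mulr1 R0 !mulr0.
(* Exposing the carrier lets [R'] keep the same operations, so the two statements are
   convertible. *)
case: R b b0 b10 => S cS b b0 b10 nz1.
pose R' : comNzRingType :=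
  HB.pack S cS (GRing.PzSemiRing_isNonZero.Build (GRing.ComPzRing.Pack cS) nz1).
exact: (@det_fps2_iter_nz R' b b0 b10 n).
Qed.
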